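(* Let $k\ge1$, let $v_1,\dots,v_k\in\mathcal{H}$ with $\mathcal{V}_k=\operatorname{span}\{v_i\}_{i=1}^k$ satisfying $\mathcal{V}_k\cap\mathcal{W}^\perp=\{0\}$, and let $\tilde u_1^k,\dots,\tilde u_k^k\in\mathcal{H}$ be vectors such that $\hat E_{\mathcal{V}_k\mathcal{W}^\perp}=\sum_{i=1}^k v_i\langle\tilde u_i^k,\cdot\rangle$. Let $j\in\{1,\dots,k\}$ be such that $v_j\notin\mathcal{V}_{k\setminus j}:=\operatorname{span}\{v_i:1\le i\le k,\ i\ne j\}$. Define $$\tilde u_i^{k\setminus j}=\tilde u_i^k-\frac{\tilde u_j^k\,\langle\tilde u_j^k,\tilde u_i^k\rangle}{\|\tilde u_j^k\|^2},\qquad i\in\{1,\dots,k\}\setminus\{j\}.$$ Then these vectors produce the oblique projector onto $\mathcal{V}_{k\setminus j}$ along $\mathcal{W}^\perp$: $$\hat E_{\mathcal{V}_{k\setminus j}\mathcal{W}^\perp}=\sum_{\substack{i=1\\ i\ne j}}^{k}v_i\langle\tilde u_i^{k\setminus j},\cdot\rangle.$$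
   Context: $\mathcal{H}$ is a complex inner product space; $\langle\cdot,\cdot\rangle$ is conjugate-linear in the first argument and linear in the second, and $v\langle u,\cdot\rangle$ denotes the operator $f\mapsto\langle u,f\rangle v$. $\mathcal{W}^\perp\subset\mathcal{H}$ is a fixed closed subspace (the symbol is just its name) for which the orthogonal projector of $\mathcal{H}$ onto it exists. For a finite-dimensional subspace $\mathcal{X}\subset\mathcal{H}$ with $\mathcal{X}\cap\mathcal{W}^\perp=\{0\}$, the oblique projector $\hat E_{\mathcal{X}\mathcal{W}^\perp}$ onto $\mathcal{X}$ along $\mathcal{W}^\perp$ is the linear operator on $\mathcal{H}$ with $\hat E_{\mathcal{X}\mathcal{W}^\perp}x=x$ for $x\in\mathcal{X}$, $\hat E_{\mathcal{X}\mathcal{W}^\perp}w=0$ for $w\in\mathcal{W}^\perp$, and $\hat E_{\mathcal{X}\mathcal{W}^\perp}f=0$ for $f$ orthogonal to $\mathcal{X}+\mathcal{W}^\perp$. (If $\mathcal{X}=\operatorname{span}\{v_i\}_{i=1}^k$ and $\hat V:\mathbb{C}^k\to\mathcal{H}$ sends the $i$-th standard basis vector to $v_i$, this is $\hat V(\hat V^*\hat P\hat V)^\dagger\hat V^*\hat P$, where $\hat P$ is the orthogonal projector onto the orthogonal complement of $\mathcal{W}^\perp$ in $\mathcal{X}+\mathcal{W}^\perp$ and $\dagger$ is the Moore-Penrose pseudo-inverse.) *)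

(* Defs.v *)
From HB Require Import structures.
From mathcomp Require Import all_boot all_order all_algebra.
From mathcomp Require Import complex.
From mathcomp Require Import all_classical all_reals all_analysis.

Set Implicit Arguments.
Unset Strict Implicit.
Unset Printing Implicit Defensive.

Import Order.TTheory GRing.Theory Num.Theory.
Import numFieldNormedType.Exports.

Local Open Scope classical_set_scope.
Local Open Scope ring_scope.
Local Open Scope complex_scope.

Section ObliqueProjectors.
Context {R : realType} {H : normedModType R[i]}.
Implicit Types (dot : {dot H for Num.conj}) (X W : set H).

(* A {dot H for Num.conj} form is linear in its FIRST argument; [inner] swaps the
   arguments so as to be conjugate-linear in the first one. *)
Definition inner dot (u v : H) : R[i] := dot v u.

(* H is an inner product space when its norm is the one induced by dot, so
   that the topology of H is the topology of the inner product. *)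
Definition norm_induced_by dot := forall x : H, `|x| ^+ 2 = inner dot x x.

Definition orthogonal_to dot (A : set H) : set H :=
  [set f | forall a, A a -> inner dot a f = 0].

Definition sum_set X W : set H := [set x + w | x in X & w in W].

Definition lspan (I : finType) (P : pred I) (v : I -> H) : set H :=
  [set x | exists c : I -> R[i], x = \sum_(i | P i) c i *: v i].

(* H need not be complete, so a closed W may have no orthogonal projector. *)
Definition is_orthogonal_projector dot W (P : H -> H) :=
  [/\ linear P, forall f, W (P f)
    & forall f, orthogonal_to dot W (f - P f)].

Definition is_oblique_projector dot X W (E : H -> H) :=
  [/\ linear E,
      forall x, X x -> E x = x,
      forall w, W w -> E w = 0
    & forall f, orthogonal_to dot (sum_set X W) f -> E f = 0].

(* The operator characterized by [is_oblique_projector]; existence and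
   uniqueness are [oblique_projectorP] and [oblique_projector_unique]. *)
Definition oblique_projector dot X W : H -> H :=
  xget (fun=> 0) [set E | is_oblique_projector dot X W E].

Section Existence.
Variables (dot : {dot H for Num.conj}) (W : set H).
Variables (I : finType) (P : pred I) (v : I -> H).
Hypothesis Wsub : submod_closed (mem W).
Hypothesis Wproj : exists Q : H -> H, is_orthogonal_projector dot W Q.
Hypothesis VW0 : lspan P v `&` W = [set 0].

Let V := lspan P v.
Let L := sum_set V W.

Let W0 : W 0. Proof. by case: Wsub => /set_mem. Qed.

Let W_lin a x y : W x -> W y -> W (a *: x + y).
Proof.
by case: Wsub => _ h Wx Wy; apply: set_mem; apply: h; apply: mem_set.
Qed.

Let V0 : V 0.
Proof. by exists (fun=> 0); rewrite big1 // => i _; rewrite scale0r. Qed.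

Let V_lin a x y : V x -> V y -> V (a *: x + y).
Proof.
move=> [c ->] [d ->]; exists (fun i => a * c i + d i).
rewrite scaler_sumr -big_split; apply: eq_bigr => i _ /=.
by rewrite scalerDl scalerA.
Qed.

Let V_gen i : P i -> V (v i).
Proof.
move=> Pi; exists (fun l => (l == i)%:R).
rewrite (bigD1 i) //= eqxx scale1r big1 ?addr0 // => l /andP[_ /negPf->].
by rewrite scale0r.
Qed.

Let L_lin a x y : L x -> L y -> L (a *: x + y).
Proof.
move=> [x1 Vx1 [x2 Wx2 <-]] [y1 Vy1 [y2 Wy2 <-]].
exists (a *: x1 + y1); first exact: V_lin.
exists (a *: x2 + y2); first exact: W_lin.
by rewrite scalerDr addrACA.
Qed.

Let VL x : V x -> L x.
Proof. by move=> Vx; exists x => //; exists 0 => //; rewrite addr0. Qed.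

Let WL x : W x -> L x.
Proof. by move=> Wx; exists 0 => //; exists x => //; rewrite add0r. Qed.

Let decomp_seq (s : seq I) : all P s -> forall f, exists a,
  [/\ L a,
      forall g, (forall w, W w -> dot g w = 0) ->
        (forall i, i \in s -> dot g (v i) = 0) -> dot g a = 0,
      forall w, W w -> dot (f - a) w = 0
    & forall i, i \in s -> dot (f - a) (v i) = 0].
Proof.
elim: s => [_ f|i0 s IH /= /andP[Pi0 /IH {}IH] f].
  have [Q [_ WQ oQ]] := Wproj; exists (Q f); split => //.
  - exact: WL.
  - by move=> g gW _; apply: gW.
  - by move=> w; apply: oQ.
have [b [Lb ab bW bs]] := IH (v i0); have [a [La aa aW as_]] := IH f.
set r := v i0 - b in bW bs; set f' := f - a in aW as_.
have rL : L r by rewrite /r addrC -scaleN1r; apply: L_lin => //; apply/VL/V_gen.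
have key : forall g, (forall w, W w -> dot g w = 0) ->
    (forall i, i \in s -> dot g (v i) = 0) -> dot g r = dot g (v i0).
  by move=> g gW gs; rewrite /r linearBr /= (ab g gW gs) subr0.
exists (dot f' r / dot r r *: r + a); rewrite opprD addrCA addrC -/f'.
split.
- exact: L_lin.
- move=> g gW gs; rewrite linearDr /= linearZr_LR /=.
  have gs' i : i \in s -> dot g (v i) = 0.
    by move=> si; apply: gs; rewrite inE si orbT.
  by rewrite (aa g gW gs') (key g gW gs') gs ?mulr0 ?addr0 // mem_head.
- by move=> w Ww; rewrite linearBl /= linearZl_LR /= (aW w) // (bW w) // mulr0 subrr.
- move=> i; have hs : i \in s -> dot (f' - dot f' r / dot r r *: r) (v i) = 0.
    by move=> si; rewrite linearBl /= linearZl_LR /= (as_ i) // (bs i) // mulr0 subrr.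
  rewrite inE => /predU1P[->{i hs}|//].
  rewrite linearBl /= linearZl_LR /= -(key f' aW as_) -(key r bW bs).
  have [->|r0] := eqVneq r 0; first by rewrite !linear0r subrr.
  by apply/eqP; rewrite subr_eq0 eq_sym; apply/eqP/divfK; rewrite dnorm_eq0.
Qed.

Let decomp f : exists x w g,
  [/\ V x, W w, orthogonal_to dot L g & f = x + w + g].
Proof.
have [|a [[x Vx [w Ww <-]] _ hW hV]] := @decomp_seq (enum P) _ f.
  by apply/allP => i; rewrite mem_enum.
exists x, w, (f - (x + w)); split => //; last by rewrite addrC subrK.
move=> _ [_ [c ->] [w' Ww' <-]]; rewrite /inner linearDr /= (hW w') // addr0.
rewrite linear_sumr big1 // => i Pi /=.
by rewrite linearZr_LR /= hV ?mulr0 // mem_enum.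
Qed.

Let decomp0 x w g : V x -> W w -> orthogonal_to dot L g ->
  x + w + g = 0 -> x = 0.
Proof.
move=> Vx Ww oLg e.
have Lxw : L (x + w) by exists x => //; exists w.
have g0 : g = 0.
  apply/eqP; rewrite -(dnorm_eq0 dot) -{2}[g](addKr (x + w)) e addr0.
  by rewrite linearNr /= oppr_eq0; apply/eqP; apply: oLg.
have xw : x = - w by apply/eqP; rewrite -addr_eq0 -[_ + w]addr0 -{1}g0 e.
suff : [set 0] x by [].
rewrite -VW0; split => //; rewrite xw -[- w]addr0 -scaleN1r.
exact: W_lin.
Qed.

Let comp f x := exists w g,
  [/\ V x, W w, orthogonal_to dot L g & f = x + w + g].

Let comp_lin a f f' x x' :
  comp f x -> comp f' x' -> comp (a *: f + f') (a *: x + x').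
Proof.
move=> [w [g [Vx Ww og ->]]] [w' [g' [Vx' Ww' og' ->]]].
exists (a *: w + w'), (a *: g + g'); split; [exact: V_lin|exact: W_lin| |].
  move=> l Ll; rewrite /inner linearPl /=.
  by move: (og l Ll) (og' l Ll); rewrite /inner => -> ->; rewrite mulr0 addr0.
by rewrite !scalerDr addrACA (addrACA (a *: x)).
Qed.

Let comp_uniq f x y : comp f x -> comp f y -> x = y.
Proof.
move=> fx fy; apply/eqP; rewrite -subr_eq0; apply/eqP.
have [w [g [Vz Ww og]]] := comp_lin (-1) fy fx.
rewrite scaleN1r addNr => /esym /decomp0 e.
by rewrite addrC -scaleN1r; apply: e.
Qed.

Lemma oblique_projectorP :
  is_oblique_projector dot V W (oblique_projector dot V W).
Proof.
apply: (@xgetPex _ (fun=> 0) [set E | is_oblique_projector dot V W E]).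
have [|E hE] := @choice _ _ comp.
  by move=> f; have [x [w [g h]]] := decomp f; exists x, w, g.
have o0 : orthogonal_to dot L 0 by move=> l _; rewrite /inner linear0l.
have EP f x : comp f x -> E f = x by apply: comp_uniq.
exists E; split.
- by move=> a f g; apply: EP; apply: comp_lin.
- by move=> x Vx; apply: EP; exists 0, 0; split => //; rewrite !addr0.
- by move=> w Ww; apply: EP; exists w, 0; split => //; rewrite addr0 add0r.
- by move=> g og; apply: EP; exists 0, g; split => //; rewrite !add0r.
Qed.

Lemma oblique_projector_unique E : is_oblique_projector dot V W E ->
  E = oblique_projector dot V W.
Proof.
move=> hE; have [l' X' W' O'] := oblique_projectorP; case: hE => l X1 W1 O1.
apply/funext => f; have [x [w [g [Vx Ww og ->]]]] := decomp f.
have D (F : H -> H) : linear F -> forall a b, F (a + b) = F a + F b.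
  by move=> lF a b; have := lF 1 a b; rewrite !scale1r.
by rewrite !(D E) // !(D (oblique_projector dot V W)) //
  X1 // X' // W1 // W' // O1 // O'.
Qed.

End Existence.
End ObliqueProjectors.

(* Main.v *)
Require Import Defs.
From HB Require Import structures.
From mathcomp Require Import all_boot all_order all_algebra.
From mathcomp Require Import complex.
From mathcomp Require Import all_classical all_reals all_analysis.

(** With E the oblique projector onto V_k and u = u_j, the sum on the right is
F f = E (f - q), where q is the orthogonal projection of f onto the line of u.
Since v_j is not in V' = span {v_i : i <> j}, <u, f> = 0 as soon as E f is in
V'; so u is orthogonal to V' and to W, and F is E = id on V', and 0 on W. If f
is orthogonal to V' + W, so is h = f - q, and E h is in V' because <u, h> = 0.
Decomposing h = E h + w + g with w in W and g orthogonal to V_k + W, both h and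
g are orthogonal to E h + w, hence E h + w = 0 and F f = E h = 0. *)

Import Order.TTheory GRing.Theory Num.Theory.
Import numFieldNormedType.Exports.

Local Open Scope classical_set_scope.
Local Open Scope ring_scope.
Local Open Scope complex_scope.

Lemma submod_closed_lin {R : pzRingType} {V : lmodType R} {A : set V} :
  submod_closed (mem A) <->
  A 0 /\ forall c x y, A x -> A y -> A (c *: x + y).
Proof.
split=> [[/set_mem A0 h]|[A0 h]].
  by split=> // c x y Ax Ay; apply: set_mem; apply: h; apply: mem_set.
by split=> [|c x y /set_mem Ax /set_mem Ay]; apply: mem_set => //; apply: h.
Qed.

Section OrthogonalDecomposition.
Context {R : realType} {H : normedModType R[i]} (dot : {dot H for Num.conj}).
Implicit Types (L W : set H).

(* The zero in [orthogonal_to] comes from another instance path, on which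
   rewriting with ring lemmas such as [mulr0] fails. *)
Lemma orthogonal_toP (A : set H) f :
  orthogonal_to dot A f <-> forall a, A a -> dot f a = 0.
Proof. by []. Qed.

(** Pointwise form of the existence of an orthogonal projector onto [L], which is not automatic
    since [H] may be incomplete. *)
Definition orth_decomposable L :=
  forall f, exists2 a, L a & orthogonal_to dot L (f - a).

Definition adjoin L (z : H) : set H := [set a + c *: z | a in L & c in setT].

Lemma adjoin_submod L z : submod_closed (mem L) ->
  submod_closed (mem (adjoin L z)).
Proof.
move=> /submod_closed_lin[L0 Llin]; apply/submod_closed_lin; split.
  by exists 0 => //; exists 0 => //; rewrite scale0r addr0.
move=> c _ _ [a La [s _ <-]] [b Lb [t _ <-]].
exists (c *: a + b); first exact: Llin.
by exists (c * s + t) => //; rewrite scalerDr scalerA scalerDl addrACA.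
Qed.

(** Gram-Schmidt step: with [r] the part of [z] orthogonal to [L], the projection of [f] onto the
    enlarged space is its projection [a] onto [L] plus the projection [t *: r] of [f - a] onto the
    line of [r]. *)
Lemma adjoin_orth_decomposable L z : submod_closed (mem L) ->
  orth_decomposable L -> orth_decomposable (adjoin L z).
Proof.
move=> /submod_closed_lin[_ Llin] Ldec f.
have [a La /orthogonal_toP oa] := Ldec f.
have [b Lb /orthogonal_toP ob] := Ldec z.
set g := f - a in oa; set r := z - b in ob.
have zE : z = r + b by rewrite subrK.
pose t := dot g r / dot r r.
have gt_orth l : L l -> dot (g - t *: r) l = 0.
  move=> Ll; rewrite linearBl /= linearZl_LR /=.
  by rewrite (oa l) // (ob l) // mulr0 subrr.
have gt_r : dot (g - t *: r) r = 0.
  (* If [r = 0], then [z] is already in [L], and [t] is 0 because division by 0 gives 0. *)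
  have [->|r0] := eqVneq r 0; first by rewrite linear0r.
  by rewrite linearBl /= linearZl_LR /= /t divfK ?subrr // dnorm_eq0.
(* This is [a + t *: r] with [r] expanded as [z - b], which exhibits it in [adjoin L z]. *)
exists (- t *: b + a + t *: z).
  by exists (- t *: b + a); [exact: Llin|exists t].
have -> : f - (- t *: b + a + t *: z) = g - t *: r.
  rewrite scaleNr [- _ + a]addrC -addrA [- _ + t *: z]addrC -scalerBr.
  by rewrite opprD addrA.
apply/orthogonal_toP => _ [l Ll [c _ <-]].
rewrite linearDr /= linearZr_LR /= zE linearDr /= gt_r add0r !gt_orth //.
by rewrite mulr0 addr0.
Qed.

(** The generators are adjoined to [W] one at a time, starting from the given projector onto [W];
    each adjunction preserves orthogonal decomposability. *)
Lemma lspan_sum_orth_decomp {I : finType} (P : pred I) (v : I -> H) W :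
  submod_closed (mem W) -> (exists Q, is_orthogonal_projector dot W Q) ->
  forall f, exists x w, [/\ lspan P v x, W w &
    orthogonal_to dot (sum_set (lspan P v) W) (f - (x + w))].
Proof.
move=> Wsub [Q [_ WQ oQ]] f.
(* Inclusion of [L] in the sum splits a projection as [x + w]; since [L] contains [W] and the
   generators, orthogonality to [L] extends to the whole sum by linearity. *)
have [L [Lsub WL LVW vL Ldec]] : exists L, [/\ submod_closed (mem L), W `<=` L,
    L `<=` sum_set (lspan P v) W, forall i, P i -> L (v i)
    & orth_decomposable L].
  suff [L [? ? ? vL ?]] : exists L, [/\ submod_closed (mem L), W `<=` L,
      L `<=` sum_set (lspan P v) W, forall i, i \in enum P -> L (v i)
      & orth_decomposable L].
    by exists L; split=> // i Pi; apply: vL; rewrite mem_enum.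
  have : all P (enum P) by apply/allP => i; rewrite mem_enum.
  elim: (enum P) => [_|i s IH /= /andP[Pi /IH [L [Lsub WL LVW vL Ldec]]]].
    exists W; split=> //; last by move=> g; exists (Q g); [exact: WQ|exact: oQ].
    move=> w Ww; exists 0; last by exists w => //; rewrite add0r.
    by exists (fun=> 0); rewrite big1 // => i _; rewrite scale0r.
  have [L0 _] := submod_closed_lin.1 Lsub.
  have LL : L `<=` adjoin L (v i).
    by move=> l Ll; exists l => //; exists 0 => //; rewrite scale0r addr0.
  exists (adjoin L (v i)); split.
  - exact: adjoin_submod.
  - exact: subset_trans LL.
  - move=> _ [_ /LVW[_ [d ->] [w Ww <-]] [c _ <-]].
    exists (\sum_(l | P l) d l *: v l + c *: v i).
      exists (fun l => d l + (if l == i then c else 0)).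
      under [RHS]eq_bigr do rewrite scalerDl; rewrite big_split; congr (_ + _).
      rewrite (bigD1 i) //= eqxx big1 ?addr0 // => l /andP[_ /negPf->].
      by rewrite scale0r.
    by exists w => //; rewrite addrAC.
  - move=> l; rewrite inE => /predU1P[->|/vL/LL //].
    by exists 0 => //; exists 1 => //; rewrite scale1r add0r.
  - exact: adjoin_orth_decomposable.
have [a /LVW[x Vx [w Ww <-]] /orthogonal_toP oa] := Ldec f.
exists x, w; split=> //; apply/orthogonal_toP => _ [_ [c ->] [w' Ww' <-]].
rewrite linearDr /= linear_sumr big1 ?add0r; first exact/oa/WL.
by move=> i Pi; rewrite /= linearZr_LR /= oa ?mulr0 //; apply: vL.
Qed.

End OrthogonalDecomposition.

(** A nonzero [c j] would allow solving for [v j] in terms of the other vectors. *)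
Lemma coord_eq0_lspan {R : realType} {H : normedModType R[i]} {I : finType}
    {v : I -> H} {j : I} {c : I -> R[i]} :
  ~ lspan (predC1 j) v (v j) ->
  lspan (predC1 j) v (\sum_i c i *: v i) -> c j = 0.
Proof.
move=> vj [d]; rewrite (bigD1 j) //= => e; apply/eqP/negPn/negP => cj.
apply: vj; exists (fun i => (c j)^-1 * (d i - c i)).
under eq_bigr do rewrite -scalerA scalerBl.
by rewrite -scaler_sumr sumrB -e addrK scalerA mulVf // scale1r.
Qed.

Lemma lspanS {R : realType} {H : normedModType R[i]} {I : finType}
    {P Q : pred I} {v : I -> H} :
  (forall i, P i -> Q i) -> lspan P v `<=` lspan Q v.
Proof.
move=> PQ _ [c ->]; exists (fun i => if P i then c i else 0).
rewrite big_mkcond [RHS]big_mkcond; apply: eq_bigr => i _.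
by have := PQ i; case: (P i) => [->|_] //; rewrite scale0r; case: (Q i).
Qed.

Theorem proposition4 (R : realType) (H : normedModType R[i])
    (dot : {dot H for Num.conj}) (Hdot : norm_induced_by dot)
    (W : set H) (Wsub : submod_closed (mem W)) (Wclosed : closed W)
    (Wproj : exists P : H -> H, is_orthogonal_projector dot W P)
    (k : nat) (k_ge1 : (1 <= k)%N) (v u : 'I_k -> H)
    (VW0 : lspan predT v `&` W = [set 0])
    (Hu : oblique_projector dot (lspan predT v) W =
          (fun f => \sum_(i < k) inner dot (u i) f *: v i))
    (j : 'I_k) (vj : ~ lspan (predC1 j) v (v j)) :
  let u' i := u i - (inner dot (u j) (u i) / `|u j| ^+ 2) *: u j in
  oblique_projector dot (lspan (predC1 j) v) W =
  (fun f => \sum_(i < k | i != j) inner dot (u' i) f *: v i).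
Proof.
move=> u'.
set E := oblique_projector dot (lspan predT v) W in Hu.
have [Elin EV EW Eorth] : is_oblique_projector dot (lspan predT v) W E.
  exact: oblique_projectorP.
have ED f g : E (f + g) = E f + E g by have := Elin 1 f g; rewrite !scale1r.
have EE f : E f = \sum_i dot f (u i) *: v i by rewrite Hu.
have V'V : lspan (predC1 j) v `<=` lspan predT v by apply: lspanS.
have V'0 : lspan (predC1 j) v 0.
  by exists (fun=> 0); rewrite big1 // => i _; rewrite scale0r.
have W0 : W 0 by have [] := submod_closed_lin.1 Wsub.
have uj0 f : lspan (predC1 j) v (E f) -> dot f (u j) = 0.
  by rewrite EE => /(coord_eq0_lspan (c := fun i => dot f (u i)) vj).
have ujX x : lspan (predC1 j) v x -> dot x (u j) = 0.
  by move=> Vx; apply: uj0; rewrite EV //; apply: V'V.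
have ujW w : W w -> dot w (u j) = 0 by move=> Ww; apply: uj0; rewrite EW.
(* If [u j] were 0, the expansion of [v j = E (v j)] would have no term in [v j], against [vj]. *)
have uj_neq0 : dot (u j) (u j) != 0.
  rewrite dnorm_eq0; apply/negP => /eqP uj_eq0; apply: vj.
  have Vvj : lspan predT v (v j).
    exists (fun i => (i == j)%:R); rewrite (bigD1 j) //= eqxx scale1r.
    by rewrite big1 ?addr0 // => i /negPf->; rewrite scale0r.
  exists (fun i => dot (v j) (u i)).
  by rewrite -{1}(EV _ Vvj) EE (bigD1 j) //= uj_eq0 linear0r scale0r add0r.
pose h f := f - (dot f (u j) / dot (u j) (u j)) *: u j.
have hj f : dot (h f) (u j) = 0.
  by rewrite linearBl /= linearZl_LR /= divfK // subrr.
have dotC x y : Num.conj (dot x y) = dot y x.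
  by rewrite [RHS]hermC expr0 mul1r.
(* Projection onto the line of [u j] is self-adjoint, so correcting every [u i] amounts to
   correcting [f]; the term of index [j] in [E (h f)] vanishes by [hj]. *)
have FE : (fun f => \sum_(i < k | i != j) inner dot (u' i) f *: v i) = E \o h.
  apply/funext => f; rewrite /= EE [RHS](bigD1 j) //= hj scale0r add0r.
  apply: eq_bigr => i _; congr (_ *: _).
  rewrite /inner /u' /h linearBr /= linearZr_LR /= linearBl /= linearZl_LR /=.
  rewrite Hdot /inner rmorphM fmorphV /= !dotC mulrAC.
  by rewrite [dot (u j) _ * _]mulrC mulrAC.
rewrite FE; symmetry; apply: oblique_projector_unique => //.
  by apply/seteqP; split=> [x [/V'V Vx Wx]|_ -> //]; rewrite -VW0.
have hid f : dot f (u j) = 0 -> h f = f.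
  by rewrite /h => ->; rewrite mul0r scale0r subr0.
split.
- move=> a f g /=; rewrite -Elin; congr (E _).
  rewrite /h linearDl /= linearZl_LR /= mulrDl scalerDl scalerBr scalerA.
  by rewrite opprD addrACA mulrA.
- by move=> x V'x /=; rewrite hid ?EV //; [exact: V'V|exact: ujX].
- by move=> w Ww /=; rewrite hid ?EW //; exact: ujW.
- move=> f /orthogonal_toP of_ /=.
  (* [h f] differs from [f] by a multiple of [u j], itself orthogonal to both summands. *)
  have h_orth a : sum_set (lspan (predC1 j) v) W a -> dot (h f) a = 0.
    move=> [x V'x [w Ww <-]]; rewrite linearBl /= linearZl_LR /=.
    rewrite of_; last by exists x => //; exists w.
    rewrite -[dot _ (x + w)]dotC linearDl /= (ujX x) // (ujW w) //.
    by rewrite addr0 rmorph0 mulr0 subr0.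
  have [x [w [Vx Ww og]]] :=
    lspan_sum_orth_decomp dot predT v W Wsub Wproj (h f).
  have Eh : E (h f) = x.
    by rewrite -(subrK (x + w) (h f)) ED Eorth // ED EV // EW // addr0 add0r.
  have V'x : lspan (predC1 j) v x.
    exists (fun i => dot (h f) (u i)).
    by rewrite -Eh EE (bigD1 j) //= hj scale0r add0r.
  have xw0 : x + w = 0.
    apply/eqP; rewrite -(dnorm_eq0 dot).
    have /orthogonal_toP/(_ (x + w)) := og; rewrite linearBl /= h_orth.
      rewrite sub0r => /(_ _)/eqP; rewrite oppr_eq0; apply.
      by exists x => //; exists w.
    by exists x => //; exists w.
  (* Now [x = - w], so [E] both fixes [x] and sends it to 0. *)
  by rewrite Eh -[LHS](EV _ Vx) -[x](addrK w) xw0 sub0r -scaleN1r -[_ *: _]addr0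
    Elin !EW // scaler0 addr0.
Qed.
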